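(* Let $X$ be a Tychonoff space and let $\aleph_\alpha\geq\aleph_1$ be a cardinal. The following statements are equivalent: (1) $X$ is pseudocompact. (2) $C_{\aleph_\alpha}(X)$ is pathwise connected. (3) $C_{\aleph_\alpha}(X)$ is connected. (4) $C_{\aleph_\alpha}(X)$ is a topological ring (under pointwise addition and multiplication).
   Context: Tychonoff means completely regular and Hausdorff. $C(X)$ is the ring (pointwise operations) of all real-valued continuous functions on $X$; $X$ is pseudocompact if every member of $C(X)$ is bounded. For an infinite cardinal $\aleph_\alpha$, $\mathcal{A}_{\aleph_\alpha}=\{A\subseteq X: |A|<\aleph_\alpha\}$. For $f\in C(X)$, $A\in\mathcal{A}_{\aleph_\alpha}$ and real $\epsilon>0$ put $B(f,A,\epsilon)=\{g\in C(X): \sup_{x\in A}|f(x)-g(x)|<\epsilon\}$ (equal to $C(X)$ when $A=\emptyset$). The sets $B(f,A,\epsilon)$ form a base of a topology on $C(X)$; $C_{\aleph_\alpha}(X)$ denotes $C(X)$ with this topology. *)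

(* Defs.v *)
From HB Require Import structures.
From mathcomp Require Import all_boot all_order all_algebra.
From mathcomp Require Import all_classical all_reals all_analysis.

Set Implicit Arguments.
Unset Strict Implicit.
Unset Printing Implicit Defensive.

Import Order.TTheory GRing.Theory Num.Theory.
Import numFieldNormedType.Exports.

Local Open Scope classical_set_scope.
Local Open Scope ring_scope.
Local Open Scope card_scope.

(* Cardinals are compared through #<=; a cardinal is given by any type having
   that cardinality. *)
Definition card_lt (T U : Type) (A : set T) (B : set U) : bool :=
  (A #<= B) && (A #!= B).
Notation "A '#<' B" := (card_lt A B) (at level 79) : card_scope.

Record infinite_cardinal := InfiniteCardinal {
  cardinal_sort :> Type;
  infinite_cardinalP : infinite_set [set: cardinal_sort]
}.

(* aleph_1 is the successor of aleph_0, so k >= aleph_1 means k > aleph_0. *)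
Definition ge_aleph1 (k : infinite_cardinal) : Prop := [set: nat] #< [set: k].

Lemma card_ltP T U (A : set T) (B : set U) :
  reflect (A #<= B /\ ~ (B #<= A)) (A #< B).
Proof.
apply: (iffP andP) => -[AB nAB]; split => //.
  by move=> BA; move/negP: nAB; apply; rewrite card_eq_le AB BA.
by apply/negP; rewrite card_eq_le => /andP[].
Qed.

Lemma card_le_rel T U (A : set T) (B : set U) (G : T -> U -> Prop) :
  (forall x, A x -> exists2 y, B y & G x y) ->
  (forall x x' y, G x y -> G x' y -> x = x') -> A #<= B.
Proof.
move=> AG Ginj.
have [->|/set0P[a /AG[b _ _]]] := eqVneq A set0.
  exact: card_ge0.
have /choice[f fP] : forall x, exists y, A x -> B y /\ G x y.
  move=> x; have [/AG[y By Gxy]|nAx] := pselect (A x); first by exists y.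
  by exists b.
have /injfunPex[g] : exists2 f : T -> U, set_fun A B f & set_inj A f.
  exists f => [x /fP[]//|x y /set_mem /fP[_ Gx] /set_mem /fP[_ Gy] fxy].
  by apply: Ginj Gx _; rewrite fxy.
exact: inj_card_le.
Qed.

Lemma card_le_fun T U (A : set T) (B : set U) (b : U) : A #<= B ->
  exists2 f : T -> U, set_fun A B f & set_inj A f.
Proof.
elim/Ppointed: U => U in B b *; first by case: (no b).
by move/pcard_leP => [f]; exists f; [exact: funS|exact: inj].
Qed.

Section infinite_halves.
Variable T : Type.
Implicit Types A B P Q : set T.

Lemma infinite_seq A : infinite_set A ->
  exists2 s : nat -> T, forall n, A (s n) & injective s.
Proof.
move=> Ainf; have [a _] := infinite_setN0 Ainf.
have /card_leP[g] := (infiniteP A).1 Ainf.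
exists (fun n => val (g (exist _ n (mem_set I)))).
  by move=> n; exact: set_valP.
move=> m n /val_inj /(@inj _ _ _ g).
by rewrite !in_setT => /(_ isT isT) [].
Qed.

Lemma card_le_setC_finite A : infinite_set [set: T] -> finite_set A ->
  [set: T] #<= ~` A.
Proof.
move=> Tinf Afin.
have [s As sinj] : exists2 s : nat -> T, forall n, (~` A) (s n) & injective s.
  by apply: infinite_seq; rewrite -setTD; exact: infinite_setD.
have [n] := Afin; rewrite card_eq_le => /andP[/pcard_leP[e] _].
have en x : A x -> (e x < n)%N by move=> Ax; exact: (@funS _ _ _ _ e).
pose G x y := [\/ A x /\ y = s (e x), exists2 k, x = s k & y = s (n + k)%N
  | [/\ ~ A x, ~ range s x & y = x]].
apply: (@card_le_rel _ _ _ _ G) => [x _|x x' y].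
  have [Ax|nAx] := pselect (A x).
    by exists (s (e x)) => //; apply: Or31.
  have [[k _ skx]|nsx] := pselect (range s x).
    by exists (s (n + k)%N) => //; apply: Or32; exists k.
  by exists x => //; apply: Or33.
case=> [[Ax ->]|[k -> ->]|[nAx nsx ->]].
- case=> [[Ax' /sinj eE]|[k -> /sinj ekn]|[_ nsx' E]].
  + by apply: (@inj _ _ _ e); rewrite ?inE.
  + by have := en _ Ax; rewrite ekn ltnNge leq_addr.
  + by case: nsx'; exists (e x).
- case=> [[Ax' /sinj ekn]|[k' -> /sinj/addnI->]//|[_ nsx' E]].
  + by have := en _ Ax'; rewrite -ekn ltnNge leq_addr.
  + by case: nsx'; exists (n + k)%N.
- case=> [[_ E]|[k _ E]|[_ _ //]]; case: nsx.
  + by rewrite E; exists (e x').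
  + by rewrite E; exists (n + k)%N.
Qed.

Lemma card_le_half (I : Type) (S : set I) (p q : I -> nat -> T) P :
  infinite_set [set: T] ->
  (forall i n, S i -> P (p i n)) -> (forall i n, S i -> ~ P (q i n)) ->
  (forall i j m n, S i -> S j -> p i m = p j n -> i = j /\ m = n) ->
  (forall i j m n, S i -> S j -> q i m = q j n -> i = j /\ m = n) ->
  finite_set [set x | P x /\ forall i n, S i -> x <> p i n] ->
  [set: T] #<= ~` P.
Proof.
move=> Tinf Pp Pq pinj qinj Rfin.
apply: card_le_trans (card_le_setC_finite Tinf Rfin) _.
pose G x y := [\/ exists i n, [/\ S i, x = p i n & y = q i n.*2],
  exists i n, [/\ S i, x = q i n & y = q i n.*2.+1]
  | [/\ ~ P x, (forall i n, S i -> x <> q i n) & y = x]].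
apply: (@card_le_rel _ _ _ _ G) => [x Rx|x x' y].
  have [Px|nPx] := pselect (P x).
    have [[i [n [Si xE]]]|nx] := pselect (exists i n, S i /\ x = p i n).
      exists (q i n.*2); first exact: Pq.
      by apply: Or31; exists i, n.
    by case: Rx; split => // i n Si xE; apply: nx; exists i, n.
  have [[i [n [Si xE]]]|nx] := pselect (exists i n, S i /\ x = q i n).
    exists (q i n.*2.+1); first exact: Pq.
    by apply: Or32; exists i, n.
  exists x => //; apply: Or33; split => // i n Si xE.
  by apply: nx; exists i, n.
have ev m n : m.*2 = n.*2.+1 -> False.
  by move=> /(congr1 odd); rewrite /= !odd_double.
case=> [[i [n [Si -> ->]]]|[i [n [Si -> ->]]]|[nPx nx ->]].
- case=> [[j [m [Sj -> /qinj[]//-> /double_inj->//]]]|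
          [j [m [Sj _ /qinj[]//_ /ev//]]]|[_ nx' E]].
  by case: (nx' i n.*2).
- case=> [[j [m [Sj _ /qinj[]//_ /esym/ev//]]]|
          [j [m [Sj -> /qinj[]//-> [/double_inj->//]]]]|[_ nx' E]].
  by case: (nx' i n.*2.+1).
- case=> [[j [m [Sj _ E]]]|[j [m [Sj _ E]]]|[_ _ //]].
  + by case: (nx j m.*2).
  + by case: (nx j m.*2.+1).
Qed.

Lemma infinite_halves P : infinite_set [set: T] ->
  [set: T] #<= P \/ [set: T] #<= ~` P.
Proof.
move=> Tinf.
pose I := ((nat -> T) * (nat -> T))%type.
pose F (S : set I) := [/\ forall i n, S i -> P (i.1 n) /\ ~ P (i.2 n),
  forall i j m n, S i -> S j -> i.1 m = j.1 n -> i = j /\ m = n &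
  forall i j m n, S i -> S j -> i.2 m = j.2 n -> i = j /\ m = n].
have [S [[SP S1 S2] Smax]] : exists S, F S /\ forall S', S `<` S' -> ~ F S'.
  apply: Zorn_bigcup => C CF Ctot; split.
  - by move=> i n [S CS Si]; have [+ _ _] := CF _ CS; apply.
  - move=> i j m n [S CS Si] [S' CS' S'j].
    have [SS'|S'S] := Ctot _ _ CS CS'.
      by have [_ + _] := CF _ CS'; apply => //; exact: SS'.
    by have [_ + _] := CF _ CS; apply => //; exact: S'S.
  - move=> i j m n [S CS Si] [S' CS' S'j].
    have [SS'|S'S] := Ctot _ _ CS CS'.
      by have [_ _] := CF _ CS'; apply => //; exact: SS'.
    by have [_ _] := CF _ CS; apply => //; exact: S'S.
pose P' := [set x | P x /\ forall i n, S i -> x <> i.1 n].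
pose Q' := [set x | (~` P) x /\ forall i n, S i -> x <> i.2 n].
have [P'fin|P'inf] := pselect (finite_set P').
  right; apply: (@card_le_half _ S fst snd) => //.
  - by move=> i n /(SP _ n)[].
  - by move=> i n /(SP _ n)[].
have [Q'fin|Q'inf] := pselect (finite_set Q').
  left; rewrite -(setCK P); apply: (@card_le_half _ S snd fst) => //.
  - by move=> i n /(SP _ n)[].
  - by move=> i n /(SP _ n)[? _]; exact.
have [s sP' sinj] := infinite_seq P'inf.
have [t tQ' tinj] := infinite_seq Q'inf.
exfalso; apply: (Smax (S `|` [set (s, t)])).
  split; first by left.
  move=> /(_ (s, t)) sub; have Sst : S (s, t) by apply: sub; right.
  by have [_ /(_ _ 0%N Sst)] := sP' 0%N.
split.
- move=> i n [/SP//|->/=].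
  by have [? _] := sP' n; have [? _] := tQ' n.
- move=> i j m n [Si|->] [Sj|->] //=; first exact: S1.
  + by move=> E; have [_ /(_ _ m Si)] := sP' n; rewrite E.
  + by move=> E; have [_ /(_ _ n Sj)] := sP' m; rewrite E.
  + by move/sinj.
- move=> i j m n [Si|->] [Sj|->] //=; first exact: S2.
  + by move=> E; have [_ /(_ _ m Si)] := tQ' n; rewrite E.
  + by move=> E; have [_ /(_ _ n Sj)] := tQ' m; rewrite E.
  + by move/tinj.
Qed.

End infinite_halves.

Section card_ltU.
Variables (T : Type) (k : infinite_cardinal).
Implicit Types A B : set T.

Let k_neq0 : exists _ : k, True.
Proof. by have [x _] := infinite_setN0 (@infinite_cardinalP k); exists x. Qed.

Lemma card_bool_le : [set: k * bool] #<= [set: k].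
Proof.
have kbinf : infinite_set [set: k * bool].
  apply/infiniteP.
  apply: card_le_trans ((infiniteP _).1 (@infinite_cardinalP k)) _.
  by apply: (@card_le_rel _ _ _ _ (fun x y => y = (x, true)))
    => [x _|x x' y -> []//]; exists (x, true).
have [H|H] := infinite_halves (fun x : k * bool => x.2) kbinf.
- apply: card_le_trans H _.
  apply: (@card_le_rel _ _ _ _ (fun x y => x = (y, true)))
    => [[x b] /= ->|x x' y -> ->//]; by exists x.
- apply: card_le_trans H _.
  apply: (@card_le_rel _ _ _ _ (fun x y => x = (y, false)))
    => [[x [|]] /= //|x x' y -> ->//]; by exists x.
Qed.

Lemma card_leU A B : A #<= [set: k] -> B #<= [set: k] ->
  A `|` B #<= [set: k].
Proof.
have [x0 _] := k_neq0.
move=> /(card_le_fun x0)[f _ finj] /(card_le_fun x0)[g _ ginj].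
apply: card_le_trans card_bool_le.
apply: (@card_le_rel _ _ _ _ (fun x y =>
    if y.2 then A x /\ y.1 = f x else B x /\ y.1 = g x)) => [x [Ax|Bx]|].
- by exists (f x, true).
- by exists (g x, false).
- move=> x x' [y [|]] /= [? ->] [? E].
  + by apply: finj; rewrite ?inE.
  + by apply: ginj; rewrite ?inE.
Qed.

Lemma card_ltU A B : A #< [set: k] -> B #< [set: k] -> A `|` B #< [set: k].
Proof.
move=> /card_ltP[Ak kA] /card_ltP[Bk kB]; apply/card_ltP; split.
  exact: card_leU.
have [t|] := pselect (exists t : T, True); last first.
  move=> T0 kAB; apply: kA; apply: card_le_trans kAB _.
  by apply: subset_card_le => x _; case: T0; exists x.
case: t => t _ /(card_le_fun t)[f fAB finj].
have [H|H] := infinite_halves (f @^-1` A) (@infinite_cardinalP k).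
- apply: kA; apply: card_le_trans H _.
  apply: (@card_le_rel _ _ _ _ (fun x y => y = f x))
    => [x Ax|x x' y -> /finj]; first by exists (f x).
  by apply; rewrite inE.
- apply: kB; apply: card_le_trans H _.
  apply: (@card_le_rel _ _ _ _ (fun x y => y = f x)) => [x nAx|x x' y -> /finj].
    by exists (f x) => //; have [] := fAB x I.
  by apply; rewrite inE.
Qed.

Lemma card_lt0 : @set0 T #< [set: k].
Proof.
have [x0 _] := k_neq0; apply/card_ltP; split; first exact: card_ge0.
by rewrite card_le0 => /eqP; rewrite -subset0 => /(_ x0 I).
Qed.

End card_ltU.

Section ring_of_continuous_functions.
Variables (R : realType) (X : topologicalType).
Implicit Types f g h : continuousType X R.

Let C0 : continuous (fun _ : X => 0 : R). Proof. by move=> x; exact: cvg_cst. Qed.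
Let C1 : continuous (fun _ : X => 1 : R). Proof. by move=> x; exact: cvg_cst. Qed.
Let CN f : continuous (fun x => - f x).
Proof. by move=> x; apply: cvgN; exact: (@cts_fun _ _ f). Qed.
Let CD f g : continuous (fun x => f x + g x).
Proof.
by move=> x; apply: cvgD; [exact: (@cts_fun _ _ f)|exact: (@cts_fun _ _ g)].
Qed.
Let CM f g : continuous (fun x => f x * g x).
Proof.
by move=> x; apply: cvgM; [exact: (@cts_fun _ _ f)|exact: (@cts_fun _ _ g)].
Qed.

Definition cts0 : continuousType X R := mkcts C0.
Definition cts1 : continuousType X R := mkcts C1.
Definition ctsN f : continuousType X R := mkcts (@CN f).
Definition ctsD f g : continuousType X R := mkcts (@CD f g).
Definition ctsM f g : continuousType X R := mkcts (@CM f g).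

Let ctsDA : associative ctsD.
Proof. by move=> f g h; apply/continuousEP => x; exact: addrA. Qed.
Let ctsDC : commutative ctsD.
Proof. by move=> f g; apply/continuousEP => x; exact: addrC. Qed.
Let cts0D : left_id cts0 ctsD.
Proof. by move=> f; apply/continuousEP => x; exact: add0r. Qed.
Let ctsND : left_inverse cts0 ctsN ctsD.
Proof. by move=> f; apply/continuousEP => x; exact: addNr. Qed.

HB.instance Definition _ :=
  GRing.isZmodule.Build (continuousType X R) ctsDA ctsDC cts0D ctsND.

Let ctsMA : associative ctsM.
Proof. by move=> f g h; apply/continuousEP => x; exact: mulrA. Qed.
Let ctsMC : commutative ctsM.
Proof. by move=> f g; apply/continuousEP => x; exact: mulrC. Qed.
Let cts1M : left_id cts1 ctsM.
Proof. by move=> f; apply/continuousEP => x; exact: mul1r. Qed.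
Let ctsMDl : left_distributive ctsM +%R.
Proof. by move=> f g h; apply/continuousEP => x; exact: mulrDl. Qed.

(* X may be empty, in which case C(X) is the zero ring. *)
HB.instance Definition _ := GRing.Zmodule_isComPzRing.Build (continuousType X R)
  ctsMA ctsMC cts1M ctsMDl.

End ring_of_continuous_functions.

HB.structure Definition PreTopologicalPzRing :=
  {T of Topological T & GRing.PzRing T}.

Definition topological_ring (T : PreTopologicalPzRing.type) : Prop :=
  [/\ continuous (fun p : T * T => p.1 + p.2),
      continuous (fun x : T => - x) &
      continuous (fun p : T * T => p.1 * p.2)].

(* C_k(X): the parameter k is only used by the topology put on this alias. *)
Definition Ctop (R : realType) (k : infinite_cardinal) (X : topologicalType) :
  Type := continuousType X R.

Section uniform_convergence_on_small_sets.
Variables (R : realType) (k : infinite_cardinal) (X : topologicalType).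
Local Notation Ctop := (Ctop R k X).

HB.instance Definition _ := GRing.ComPzRing.copy Ctop (continuousType X R).
HB.instance Definition _ := isPointed.Build Ctop 0.

(* The supremum is taken in the extended reals: it is +oo when f - g is
   unbounded on A, and -oo when A is empty. *)
Definition Cball (f : Ctop) (A : set X) (e : R) : set Ctop :=
  [set g : Ctop | (ereal_sup [set `|f x - g x|%:E | x in A] < e%:E)%E].

Lemma CballP f A e g : 0 < e -> Cball f A e g <->
  exists2 d, d < e & forall x, A x -> `|f x - g x| <= d.
Proof.
move=> e0; split => [|[d de fgd]]; last first.
  apply: (@le_lt_trans _ _ d%:E); last by rewrite lte_fin.
  by apply: ge_ereal_sup => _ [x Ax <-]; rewrite lee_fin fgd.
rewrite /Cball /=; set s := ereal_sup _ => se.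
have fgs x : A x -> (`|f x - g x|%:E <= s)%E.
  by move=> Ax; apply: ereal_sup_ubound; exists x.
have [sfin|] := boolP (s \is a fin_num).
  exists (fine s); first by rewrite -lte_fin fineK.
  by move=> x /fgs; rewrite -lee_fin fineK.
rewrite fin_numE negb_and !negbK => /orP[/eqP sE|/eqP sE]; last first.
  by move: se; rewrite sE.
by exists 0 => // x /fgs; rewrite sE leeNy_eq.
Qed.

(* The index (f, A, e) stands for Cball f A e. *)
Let D : set (Ctop * set X * R) :=
  [set i | i.1.2 #< [set: k] /\ 0 < i.2].
Let b (i : Ctop * set X * R) : set Ctop := Cball i.1.1 i.1.2 i.2.

Let b_cover : \bigcup_(i in D) b i = setT.
Proof.
apply/seteqP; split => // f _; exists (f, set0, 1).
  by split; [exact: card_lt0|exact: ltr01].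
by apply/CballP => //; exists 0.
Qed.

Let b_join i j t : D i -> D j -> b i t -> b j t ->
  exists l, [/\ D l, b l t & b l `<=` b i `&` b j].
Proof.
case: i j => [[f A] e] [[g B] e'] [/= Ak e0] [/= Bk e'0].
move=> /CballP -/(_ e0)[d de fd] /CballP -/(_ e'0)[d' d'e' gd'].
have m0 : 0 < Num.min (e - d) (e' - d') by rewrite lt_min !subr_gt0 de d'e'.
exists (t, A `|` B, Num.min (e - d) (e' - d')); split.
- by split => //=; exact: card_ltU.
- apply/CballP => //; exists 0 => // x _; by rewrite subrr normr0.
- move=> h /CballP -/(_ m0)[r]; rewrite lt_min => /andP[re re'] th.
  split; apply/CballP => //=.
  + exists (d + r); first by rewrite addrC -ltrBrDr.
    move=> x Ax; rewrite (le_trans (ler_distD (t x) _ _))// lerD ?fd//.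
    by apply: th; left.
  + exists (d' + r); first by rewrite addrC -ltrBrDr.
    move=> x Bx; rewrite (le_trans (ler_distD (t x) _ _))// lerD ?gd'//.
    by apply: th; right.
Qed.

HB.instance Definition _ := isBaseTopological.Build Ctop b_cover b_join.

End uniform_convergence_on_small_sets.

Definition tychonoff_space (X : topologicalType) : Prop :=
  completely_regular_space X /\ hausdorff_space X.

Definition pseudocompact (R : realType) (X : topologicalType) : Prop :=
  forall f : continuousType X R, bounded_fun f.

Definition pathwise_connected (R : realType) (T : topologicalType) : Prop :=
  forall x y : T, exists2 p : R -> T,
    {within `[0, 1], continuous p} & p 0 = x /\ p 1 = y.

(* Main.v *)
Require Import Defs.
From mathcomp Require Import all_boot all_order all_algebra.
From mathcomp Require Import all_classical all_reals all_analysis.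
Local Open Scope classical_set_scope.

(** If every continuous function is bounded, then multiplication is continuous
    by the usual estimate, and segments [f + t (g - f)] are continuous paths.
    Conversely, an unbounded [f] is already unbounded on a countable set [A],
    and [|A| < k] because [k >= aleph_1]. The functions bounded on [A] then form
    a proper nonempty clopen set, so [C_k(X)] is disconnected; and
    multiplication is not continuous at [(f, 0)], because neighbourhoods of [0]
    contain nonzero constants while [f * c] is unbounded on [A] for every
    constant [c <> 0]. *)

Set Implicit Arguments.
Unset Strict Implicit.
Unset Printing Implicit Defensive.

Import Order.TTheory GRing.Theory Num.Theory.
Import numFieldNormedType.Exports.
Local Open Scope ring_scope.
Local Open Scope card_scope.

Definition bounded_on (R : realType) (X : Type) (A : set X) (f : X -> R) :=
  exists M : R, forall x, A x -> `|f x| <= M.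

Lemma bounded_on_gt0 (R : realType) (X : Type) (A : set X) (f : X -> R) :
  bounded_on A f -> exists2 M : R, 0 < M & forall x, A x -> `|f x| <= M.
Proof.
move=> [M fM]; exists (`|M| + 1); first by rewrite ltr_wpDl.
by move=> x Ax; rewrite (le_trans (fM _ Ax))// ler_wpDr// ler_norm.
Qed.

Lemma bounded_funP (R : realType) (X : Type) (f : X -> R) :
  bounded_fun f <-> bounded_on setT f.
Proof.
split=> [/pinfty_ex_gt0[M _ fM]|[M fM]]; first by exists M => x; exact: fM.
apply: filterS (nbhs_pinfty_ge (num_real M)) => N MN x _ /=.
exact: le_trans (fM x I) MN.
Qed.

(** For an unbounded [f], choosing for each [n] a point where [|f|] exceeds [n] gives a countable
    set on which [f] is unbounded. *)
Lemma countable_unbounded (R : realType) (X : Type) (f : X -> R) :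
  (forall A : set X, countable A -> bounded_on A f) -> bounded_fun f.
Proof.
move=> fA; apply/bounded_funP; apply: contrapT => nf.
have /choice[s sP] : forall n : nat, exists x, n%:R < `|f x|.
  move=> n; apply: contrapT => nx; apply: nf; exists n%:R => x _.
  by rewrite leNgt; apply/negP => nfx; apply: nx; exists x.
have [M sM] : bounded_on (range s) f by apply: fA; exact: card_image_le.
have [n Mn] : exists n : nat, M <= n%:R.
  exists (Num.bound `|M|); rewrite (le_trans (ler_norm M))// ltW//.
  exact: archi_boundP.
have := sM (s n) (imageP _ I).
by rewrite leNgt (le_lt_trans Mn (sP n)).
Qed.

(** The assumption [k >= aleph_1] enters only through this fact: countable sets may index basic
    neighbourhoods. *)
Lemma countable_card_lt (X : Type) (k : infinite_cardinal) (A : set X) :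
  ge_aleph1 k -> countable A -> A #< [set: k].
Proof.
move=> /card_ltP[nk kn] An; apply/card_ltP; split.
  exact: card_le_trans An nk.
by move=> kA; apply: kn; exact: card_le_trans kA An.
Qed.

Section Ctop_theory.
Variables (R : realType) (k : infinite_cardinal) (X : topologicalType).
Local Notation Ctop := (Ctop R k X).
Implicit Types f g : Ctop.

Definition Cclosed_ball f (A : set X) (e : R) : set Ctop :=
  [set g : Ctop | forall x, A x -> `|f x - g x| <= e].

(** A basic open set around [f] may be centred elsewhere; the triangle inequality recentres it at
    [f]. Closed balls trade the strict supremum for pointwise bounds. *)
Lemma nbhs_CtopP f (U : set Ctop) :
  nbhs f U <-> exists (A : set X) (e : R), [/\ A #< [set: k], 0 < e &
    Cclosed_ball f A e `<=` U].
Proof.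
split=> [|[A [e [Ak e0 AU]]]].
  rewrite nbhsE => -[V [[D' D'D VE] Vf] VU].
  move: Vf; rewrite -VE => -[[[h A] e] D'i /=].
  have [/= Ak e0] := D'D _ D'i.
  move=> /(CballP _ _ _ e0)[d de hf].
  (* On [A], [f] is within [d < e] of the centre [h]; using half of the slack keeps the total
     strictly below [e]. *)
  exists A, ((e - d) / 2); split => //; first by rewrite divr_gt0 ?subr_gt0.
  move=> g fg; apply: VU; rewrite -VE; exists (h, A, e) => //=.
  apply/(CballP _ _ _ e0); exists (d + (e - d) / 2).
    by rewrite -ltrBrDl ltr_pdivrMr// ltr_pMr ?subr_gt0// ltr1n.
  move=> x Ax; rewrite (le_trans (ler_distD (f x) _ _))// lerD ?hf//.
  exact: fg.
rewrite nbhsE; exists (Cball f A e); last first.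
  move=> g /(CballP _ _ _ e0)[d de fg]; apply: AU => x Ax.
  by rewrite (le_trans (fg _ Ax))// ltW.
split.
  exists [set (f, A, e)]; first by move=> _ ->.
  by rewrite bigcup_set1.
by apply/(CballP _ _ _ e0); exists 0 => // x _; rewrite subrr normr0.
Qed.

Lemma nbhs_Ctop f (A : set X) (e : R) : A #< [set: k] -> 0 < e ->
  nbhs f (Cclosed_ball f A e).
Proof. by move=> Ak e0; apply/nbhs_CtopP; exists A, e; split. Qed.

Definition cts_const (a : R) : Ctop := mkcts (@cst_continuous X R a).

(** Moving by at most 1 on [A] changes neither boundedness nor unboundedness on [A], so the set and
    its complement both contain a ball of radius 1 around each of their points. *)
Lemma clopen_bounded_on (A : set X) : A #< [set: k] ->
  clopen [set f : Ctop | bounded_on A f].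
Proof.
move=> Ak.
have step f g : (forall x, A x -> `|f x - g x| <= 1) ->
    bounded_on A f -> bounded_on A g.
  move=> fg [M fM]; exists (M + 1) => x Ax.
  rewrite -[g x](subrK (f x)) addrC (le_trans (ler_normD _ _))//.
  by rewrite lerD ?fM// distrC fg.
split.
  rewrite openE => f fb.
  by apply: filterS (nbhs_Ctop f Ak ltr01) => g /step; exact.
rewrite -openC openE => f fb.
apply: filterS (nbhs_Ctop f Ak ltr01) => g fg gb; apply: fb.
by apply: step gb => x Ax; rewrite distrC fg.
Qed.

Lemma connected_pseudocompact : ge_aleph1 k -> connected [set: Ctop] ->
  pseudocompact R X.
Proof.
move=> k1 conn f; apply: countable_unbounded => A /(countable_card_lt k1) Ak.
have [oB cB] := clopen_bounded_on Ak.
suff BT : [set f : Ctop | bounded_on A f] = setT.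
  by have : [set: Ctop] f by []; rewrite -BT.
apply: conn.
- by exists 0, 0 => x _; rewrite normr0.
- by exists [set f : Ctop | bounded_on A f] => //; rewrite setTI.
- by exists [set f : Ctop | bounded_on A f] => //; rewrite setTI.
Qed.

Lemma topological_ring_pseudocompact : ge_aleph1 k ->
  topological_ring Ctop -> pseudocompact R X.
Proof.
move=> k1 [_ _ mulC] f; apply: countable_unbounded => A.
move=> /(countable_card_lt k1) Ak.
have [[P Q] [/= Pf Q0] PQ] :=
  mulC (f : Ctop, 0) _ (nbhs_Ctop ((f : Ctop) * 0) Ak ltr01).
have [A' [d [_ d0 dQ]]] := (nbhs_CtopP _ _).1 Q0.
(* The constant [d] lies on the boundary of the closed [d]-ball around 0. Hence [f * d] is within 1
   of 0 on [A], which bounds [f] there by [d^-1]. *)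
have Qd : Q (cts_const d) by apply: dQ => x _; rewrite sub0r normrN gtr0_norm.
exists d^-1 => x Ax.
have := PQ (f : Ctop, cts_const d) (conj (nbhs_singleton Pf) Qd) x Ax.
rewrite /= distrC -[X in `|X|]/(f x * d - f x * 0) mulr0 subr0.
by rewrite normrM (gtr0_norm d0) -ler_pdivlMr// div1r.
Qed.

Lemma addC_continuous : continuous (fun p : Ctop * Ctop => p.1 + p.2).
Proof.
move=> [f g] U /nbhs_CtopP[A [e [Ak e0 AU]]].
have e20 : 0 < e / 2 by rewrite divr_gt0.
exists (Cclosed_ball f A (e / 2), Cclosed_ball g A (e / 2)) => /=.
  by split; exact: nbhs_Ctop.
move=> [f' g'] /= [ff' gg']; apply: AU => x Ax.
rewrite -[X in `|X|]/((f x + g x) - (f' x + g' x)) opprD addrACA.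
by rewrite (le_trans (ler_normD _ _))// [leRHS]splitr lerD ?ff'// gg'.
Qed.

Lemma oppC_continuous : continuous (fun f : Ctop => - f).
Proof.
move=> f U /nbhs_CtopP[A [e [Ak e0 AU]]].
apply: filterS (nbhs_Ctop f Ak e0) => g fg; apply: AU => x Ax.
by rewrite -[X in `|X|]/(- f x - - g x) -opprD normrN fg.
Qed.

Lemma mulC_continuous : pseudocompact R X ->
  continuous (fun p : Ctop * Ctop => p.1 * p.2).
Proof.
move=> psX [f g] U /nbhs_CtopP[A [e [Ak e0 AU]]].
have [M M0 fM] := bounded_on_gt0 ((bounded_funP _).1 (psX f)).
have [N N0 gN] := bounded_on_gt0 ((bounded_funP _).1 (psX g)).
have S0 : 0 < M + (N + 1) by rewrite !addr_gt0.
(* The bound [d <= 1] gives [|g'| <= N + 1] on [A]; the error [f (g - g') + g' (f - f')] is then at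
   most [(M + (N + 1)) * d <= e]. *)
pose d := Num.min 1 (e / (M + (N + 1))).
have d0 : 0 < d by rewrite lt_min ltr01 divr_gt0.
have d1 : d <= 1 by rewrite ge_min lexx.
have dS : (M + (N + 1)) * d <= e.
  by rewrite mulrC -ler_pdivlMr// ge_min lexx orbT.
exists (Cclosed_ball f A d, Cclosed_ball g A d) => /=.
  by split; exact: nbhs_Ctop.
move=> [f' g'] /= [ff' gg']; apply: AU => x Ax.
have g'N : `|g' x| <= N + 1.
  rewrite -[g' x](subrK (g x)) addrC (le_trans (ler_normD _ _))//.
  by rewrite lerD ?gN// distrC (le_trans (gg' x Ax)).
have -> : (f * g) x - (f' * g') x =
    f x * (g x - g' x) + g' x * (f x - f' x).
  rewrite -[LHS]/(f x * g x - f' x * g' x) !mulrBr addrA.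
  by rewrite (mulrC (g' x) (f x)) subrK (mulrC (f' x)).
apply: le_trans dS; rewrite mulrDl (le_trans (ler_normD _ _))// !normrM.
by rewrite lerD// ler_pM ?fM ?ff' ?gg'.
Qed.

Lemma pseudocompact_topological_ring : pseudocompact R X ->
  topological_ring Ctop.
Proof.
move=> psX; split; [exact: addC_continuous|exact: oppC_continuous|].
exact: mulC_continuous.
Qed.

Lemma pseudocompact_pathwise_connected : pseudocompact R X ->
  pathwise_connected R Ctop.
Proof.
move=> psX f g; exists (fun t : R => f + cts_const t * (g - f)); last first.
  split; apply/continuousEP => x.
  - by rewrite -[LHS]/(f x + 0 * (g x - f x)) mul0r addr0.
  - by rewrite -[LHS]/(f x + 1 * (g x - f x)) mul1r addrC subrK.
apply: continuous_subspaceT => s U /nbhs_CtopP[A [e [Ak e0 AU]]].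
have [M M0 gfM] := bounded_on_gt0 ((bounded_funP _).1 (psX (g - f))).
(* Points of the segment with parameters [s] and [t] differ by [(s - t) * (g - f)], hence by at most
   [|s - t| * M]. *)
apply/nbhs_ballP; exists (e / M); first by rewrite /= divr_gt0.
move=> t /= st; apply: AU => x Ax.
have -> : (f + cts_const s * (g - f)) x - (f + cts_const t * (g - f)) x =
    (s - t) * (g - f) x.
  rewrite -[LHS]/((f x + s * (g - f) x) - (f x + t * (g - f) x)).
  by rewrite opprD addrACA subrr add0r mulrBl.
rewrite normrM (le_trans (ler_wpM2l (normr_ge0 _) (gfM x I)))//.
by rewrite -ler_pdivlMr// ltW.
Qed.

End Ctop_theory.

(** The images of the paths starting at a fixed [x] are connected, share [x] and cover the space. An
    empty space has no such [x] and is treated apart. *)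
Lemma pathwise_connected_connected (R : realType) (T : topologicalType) :
  pathwise_connected R T -> connected [set: T].
Proof.
move=> pT; have [->|/set0P[x _]] := eqVneq [set: T] set0; first exact: connected0.
have -> : [set: T] =
    \bigcup_(C in [set C : set T | C x /\ connected C]) C.
  apply/seteqP; split => // y _; have [p pc [p0 p1]] := pT x y.
  have I01 (t : R) : 0 <= t <= 1 -> (p @` `[0, 1]) (p t).
    by move=> t01; exists t => //=; rewrite in_itv.
  exists (p @` `[0, 1]); last by rewrite -p1; apply: I01; rewrite ler01 lexx.
  split; first by rewrite -p0; apply: I01; rewrite lexx ler01.
  by apply: connected_continuous_connected pc; exact: segment_connected.
by apply: bigcup_connected; [exists x => C []|move=> C []].
Qed.

Theorem theorem3p15 (R : realType) (X : topologicalType)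
    (k : infinite_cardinal) (tychonoffX : tychonoff_space X)
    (k_ge : ge_aleph1 k) :
  [<-> pseudocompact R X;
       pathwise_connected R (Ctop R k X);
       connected [set: Ctop R k X];
       topological_ring (Ctop R k X)].
Proof.
tfae.
- exact: pseudocompact_pathwise_connected.
- exact: pathwise_connected_connected.
(* From connectedness to the ring structure the argument passes through pseudocompactness. *)
- move/(connected_pseudocompact k_ge).
  exact: pseudocompact_topological_ring.
- exact: topological_ring_pseudocompact.
Qed.
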